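(* Let $\alpha, \beta, \gamma$ be non-negative integers with $\alpha \geq 0$, $\beta \geq 1$, and $\beta + \gamma \geq 3$, and let $G = G(\alpha, \beta, \gamma)$. Then $G$ is not dimension-critical.
   Context: All graphs are finite and simple. A graph $G$ is representable (embeddable) in $\mathbb{R}^n$ if its vertices can be placed at distinct points of $\mathbb{R}^n$ so that any two adjacent vertices are at Euclidean distance exactly 1 (non-adjacent vertices are also allowed to be at distance 1). By convention, $\mathbb{R}^0$ is a single point. The dimension $\dim(G)$ is the smallest integer $n \ge 0$ such that $G$ is representable in $\mathbb{R}^n$. A non-empty graph $G$ is dimension-critical if every proper subgraph $H$ of $G$ (not necessarily induced) satisfies $\dim(H) < \dim(G)$. For non-negative integers $\alpha,\beta,\gamma$, $G(\alpha,\beta,\gamma)$ denotes the complete multipartite graph with $\alpha+\beta+\gamma$ parts, of which $\alpha$ have size 1, $\beta$ have size 2, and $\gamma$ have size 3. *)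

(* Defs.v *)
From mathcomp Require Import all_boot all_order all_algebra.
From mathcomp Require Import boolp reals.

Set Implicit Arguments.
Unset Strict Implicit.
Unset Printing Implicit Defensive.

Import Order.TTheory GRing.Theory Num.Theory.
Local Open Scope ring_scope.

(* Graphs carry a vertex set inside an ambient finite type, so that a graph   *)
(* and all its (not necessarily induced) subgraphs live in the same type.     *)
Record graph (T : finType) := Graph {
  vset : {set T};
  adj : rel T;
  adj_sym : symmetric adj;
  adj_irr : irreflexive adj;
  adj_vset : forall x y, adj x y -> x \in vset
}.

Definition subgraph (T : finType) (H G : graph T) : Prop :=
  vset H \subset vset G /\ (forall x y : T, adj H x y -> adj G x y).

Definition proper_subgraph (T : finType) (H G : graph T) : Prop :=
  subgraph H G /\ ~ subgraph G H.

(* The library norm on row vectors is the max norm, hence this definition.    *)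
Definition edist (R : realType) (n : nat) (u v : 'rV[R]_n) : R :=
  Num.sqrt (\sum_(i < n) (u 0 i - v 0 i) ^+ 2).

Definition representable (R : realType) (T : finType) (G : graph T) (n : nat) :
    Prop :=
  exists f : T -> 'rV[R]_n,
    {in vset G &, injective f} /\
    (forall x y : T, adj G x y -> edist (f x) (f y) = 1).

(* Place the vertices at the points e_i / sqrt 2 of R^#|T|.                   *)
Lemma representable_ex (R : realType) (T : finType) (G : graph T) :
  exists n, `[< representable R G n >].
Proof.
exists #|T|; apply/asboolP.
pose c : R := (Num.sqrt 2)^-1.
have c2 : c ^+ 2 = 2^-1 by rewrite /c exprVn sqr_sqrtr.
have c0 : c != 0 by rewrite -sqrf_eq0 c2 invr_eq0 pnatr_eq0.
exists (fun x => \row_j (if j == enum_rank x then c else 0)); split.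
  move=> x y _ _ /rowP/(_ (enum_rank x)); rewrite !mxE eqxx.
  by case: eqP => [/enum_rank_inj //|_ /eqP]; rewrite (negPf c0).
move=> x y xy.
have nxy : enum_rank y != enum_rank x.
  by rewrite (inj_eq enum_rank_inj); apply: contraTneq xy => ->; rewrite adj_irr.
rewrite /edist (bigD1 (enum_rank x)) //= (bigD1 (enum_rank y)) //= big1.
  rewrite !mxE !eqxx eq_sym !(negPf nxy) subr0 sub0r sqrrN c2 addr0.
  by rewrite -mulr2n -[X in X *+ 2]mul1r -mulrnAr -(mulr_natr _^-1) mulVf
    ?pnatr_eq0 // mulr1 sqrtr1.
by move=> i /andP[ix iy]; rewrite !mxE (negPf ix) (negPf iy) subr0 expr0n.
Qed.

Definition dim (R : realType) (T : finType) (G : graph T) : nat :=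
  ex_minn (representable_ex R G).

Definition dim_critical (R : realType) (T : finType) (G : graph T) : Prop :=
  vset G != set0 /\
  (forall H : graph T, proper_subgraph H G -> (dim R H < dim R G)%N).

Definition part_size (a b i : nat) : nat :=
  if (i < a)%N then 1%N else if (i < a + b)%N then 2%N else 3%N.

(* A vertex is a pair (part, position inside the part).                       *)
Definition mp_vertex (a b c : nat) : finType :=
  {i : 'I_(a + b + c) & 'I_(part_size a b i)}.

Definition mp_adj (a b c : nat) : rel (mp_vertex a b c) :=
  fun u v => tag u != tag v.

Lemma mp_adj_sym (a b c : nat) : symmetric (@mp_adj a b c).
Proof. by move=> u v; rewrite /mp_adj eq_sym. Qed.

Lemma mp_adj_irr (a b c : nat) : irreflexive (@mp_adj a b c).
Proof. by move=> u; rewrite /mp_adj eqxx. Qed.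

Lemma mp_adj_vset (a b c : nat) (u v : mp_vertex a b c) :
  mp_adj u v -> u \in [set: mp_vertex a b c].
Proof. by rewrite inE. Qed.

Definition mp_graph (a b c : nat) : graph (mp_vertex a b c) :=
  Graph (@mp_adj_sym a b c) (@mp_adj_irr a b c) (@mp_adj_vset a b c).

(* Main.v *)
(* Deleting a vertex [r] of a part of size two does not lower the dimension.  *)
(* Put N = a + b + 2c.  On the one hand G embeds in R^N: send the vertices to *)
(* points [+- e_s / sqrt 2], any two parts using disjoint sets of axes, each  *)
(* part of size two or three containing an antipodal pair.  On the other      *)
(* hand, in a unit distance representation of G - r let [z] be the vertex     *)
(* left alone by [r].  The directions of the parts are mutually orthogonal    *)
(* and orthogonal to the differences [s - z] for single vertices [s], which   *)
(* gives N - 1 independent vectors.  They cannot span: two further parts,     *)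
(* which exist since b + c >= 3, would both be centred at the centroid of the *)
(* simplex of single vertices, with radius greater than 1 / sqrt 2, and their *)
(* points would be more than 1 apart.                                         *)
Require Import Defs.
From mathcomp Require Import all_boot all_order all_algebra.
From mathcomp Require Import boolp reals.
From mathcomp Require Import ring lra zify.

Set Implicit Arguments.
Unset Strict Implicit.
Unset Printing Implicit Defensive.

Import Order.TTheory GRing.Theory Num.Theory.
Local Open Scope ring_scope.

(** The deleted vertex belongs to a part of size two; it suffices that the graph fits in N = a + b +
    2c dimensions and that what remains does not fit in fewer. The upper bound,
    [mp_graph_representable], places the vertices on signed axes. For the lower bound, unit
    distances become inner product relations ([dot_part], [dot_star]) that make N - 1 difference
    vectors independent ([free_star]). By [unit_distance_dim] these cannot span: the vectors from
    the surviving vertex z to two further parts would have inner product |B| / (2 (1 + |B|)), with B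
    the set of single vertices, whereas unit distances demand 1/2. *)

(** * Linear algebra and the Euclidean inner product *)

Lemma free_span_full (F : fieldType) (T : finType) (A : {set T}) (n : nat)
    (g : T -> 'rV[F]_n) :
  (forall l : T -> F,
     \sum_(v in A) l v *: g v = 0 -> {in A, forall v, l v = 0}) ->
  (n <= #|A|)%N ->
  forall e : 'rV[F]_n, exists l : T -> F, e = \sum_(v in A) l v *: g v.
Proof.
move=> freeg leA e; have [A0|[x0 x0A]] := set_0Vmem A.
  move: leA; rewrite A0 cards0 leqn0 => /eqP n0; exists (fun=> 0).
  by apply/rowP=> i; have := leq_trans (ltn_ord i) (eq_leq n0).
pose U : 'M[F]_(#|A|, n) := \matrix_(i < #|A|) g (enum_val i).
have UE (l : 'rV[F]_#|A|) :
    l *m U = \sum_(v in A) l 0 (enum_rank_in x0A v) *: g v.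
  rewrite mulmx_sum_row [RHS]big_enum_val; apply: eq_bigr => i _.
  by rewrite rowK enum_valK_in.
have freeU : row_free U.
  rewrite -kermx_eq0; apply/eqP/row_matrixP => i; rewrite row0.
  have := UE (row i (kermx U)); rewrite -row_mul mulmx_ker row0.
  move=> /esym/freeg l0.
  by apply/rowP => j; rewrite -(enum_valK_in x0A j) l0 ?enum_valP // mxE.
have fullU : row_full U.
  by rewrite /row_full eqn_leq rank_leq_col (eqP freeU).
have /submxP[l ->] := submx_full e fullU.
by exists (fun v => l 0 (enum_rank_in x0A v)); rewrite UE.
Qed.

Definition dot (R : pzRingType) (n : nat) (u v : 'rV[R]_n) : R :=
  \sum_(i < n) u 0 i * v 0 i.

Section Dot.
Variables (R : realFieldType) (n : nat).
Implicit Types u v w : 'rV[R]_n.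

Lemma dotC u v : dot u v = dot v u.
Proof. by apply: eq_bigr => i _; rewrite mulrC. Qed.

Lemma dotDl u v w : dot (u + v) w = dot u w + dot v w.
Proof. by rewrite -big_split; apply: eq_bigr => i _; rewrite mxE mulrDl. Qed.

Lemma dotNl u w : dot (- u) w = - dot u w.
Proof. by rewrite -sumrN; apply: eq_bigr => i _; rewrite mxE mulNr. Qed.

Lemma dotZl (a : R) u w : dot (a *: u) w = a * dot u w.
Proof. by rewrite mulr_sumr; apply: eq_bigr => i _; rewrite mxE mulrA. Qed.

Lemma dot0l w : dot 0 w = 0.
Proof. by rewrite -(scale0r (0 : 'rV[R]_n)) dotZl mul0r. Qed.

Lemma dotDr u v w : dot w (u + v) = dot w u + dot w v.
Proof. by rewrite dotC dotDl !(dotC w). Qed.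

Lemma dotNr u w : dot w (- u) = - dot w u.
Proof. by rewrite dotC dotNl (dotC w). Qed.

Lemma dotZr (a : R) u w : dot w (a *: u) = a * dot w u.
Proof. by rewrite dotC dotZl (dotC w). Qed.

Lemma dot_suml (I : Type) (r : seq I) (P : pred I) (F : I -> 'rV[R]_n) w :
  dot (\sum_(i <- r | P i) F i) w = \sum_(i <- r | P i) dot (F i) w.
Proof.
by apply: (big_morph (fun u => dot u w)) => [u v|]; rewrite ?dotDl ?dot0l.
Qed.

Lemma dot_eq0 u : dot u u = 0 -> u = 0.
Proof.
move/eqP; rewrite psumr_eq0 => [/allP u0|i _]; last by rewrite -expr2 sqr_ge0.
apply/rowP => i; rewrite mxE; apply/eqP; rewrite -sqrf_eq0 expr2.
exact: u0 (mem_index_enum i).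
Qed.

Definition dotE := (dotDl, dotDr, dotNl, dotNr, dotZl, dotZr).

(* Three distinct points of a sphere are affinely independent; here [y] goes *)
(* from the centre to the first point and [g], [h] from it to the others.    *)
Lemma sphere_free (y g h : 'rV[R]_n) (a b : R) :
  dot (y + g) (y + g) = dot y y -> dot (y + h) (y + h) = dot y y ->
  g != 0 -> h != 0 -> g != h -> a *: g + b *: h = 0 -> a = 0.
Proof.
move=> yg yh g0 h0 gh ab; apply/eqP; apply: contraT => a0.
have dab w : a * dot g w + b * dot h w = 0.
  by rewrite -!dotZl -dotDl ab dot0l.
have q u : u != 0 -> dot u u != 0 by apply: contraNneq => /dot_eq0 ->.
have /q := g0; have /q := h0 => qh qg.
(* The sphere conditions say that 2 y.g = - g.g and 2 y.h = - h.h; substitute them into the relation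
   paired with [y]. *)
have abq : a * dot g g + b * dot h h = 0.
  by move: yg yh (dab y); rewrite !dotE (dotC g y) (dotC h y); nra.
have b0 : b != 0.
  apply: contraNneq a0 => b0; move: abq.
  by rewrite b0 mul0r addr0 => /eqP; rewrite mulf_eq0 (negPf qg) orbF.
have := dab g; have := dab h; rewrite (dotC h g) => e1 e2.
have /(mulfI a0) m1 : a * dot g g = a * dot g h by lra.
have /(mulfI b0) m2 : b * dot h h = b * dot g h by lra.
case/negP: gh; rewrite -subr_eq0; apply/eqP/dot_eq0.
by rewrite !dotE (dotC h g) m1 m2; ring.
Qed.

End Dot.

(** * Independence and non-spanning of the difference vectors *)

Section UnitDistance.
Variables (R : realFieldType) (n : nat) (T : finType) (K : eqType).
Variables (t : T -> K) (f : T -> 'rV[R]_n) (D : {set T}).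
Hypothesis unit_f : {in D &, forall x y, t x != t y ->
  dot (f x - f y) (f x - f y) = 1}.
Hypothesis inj_f : {in D &, injective f}.

(** Twice the inner product is an alternating sum of four squared distances, all equal to 1. The
    vertices [u] and [u'] may lie in different parts, so one of them can be [z]. *)
Lemma dot_part (x x' u u' : T) : x \in D -> x' \in D -> u \in D -> u' \in D ->
  t x' = t x -> t u != t x -> t u' != t x ->
  dot (f x - f x') (f u - f u') = 0.
Proof.
move=> xD x'D uD u'D tx tu tu'.
have := unit_f uD xD; have := unit_f u'D xD.
have := unit_f uD x'D; have := unit_f u'D x'D.
rewrite tx tu tu' !dotE (dotC (f x) (f u)) (dotC (f x') (f u)).
rewrite (dotC (f x) (f u')) (dotC (f x') (f u')).
by move=> /(_ isT) e1 /(_ isT) e2 /(_ isT) e3 /(_ isT) e4; lra.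
Qed.

Lemma dot_star (z x y : T) : z \in D -> x \in D -> y \in D ->
  t x != t z -> t y != t z -> t x != t y ->
  dot (f x - f z) (f y - f z) = 2^-1.
Proof.
move=> zD xD yD txz tyz txy.
have := unit_f xD zD txz; have := unit_f yD zD tyz; have := unit_f xD yD txy.
rewrite !dotE (dotC (f z) (f x)) (dotC (f z) (f y)) (dotC (f y) (f x)).
by move=> e1 e2 e3; lra.
Qed.

(* [z] and the elements of [B] are single vertices of distinct parts; [C]     *)
(* consists of the vertices, other than a base vertex, of further parts of    *)
(* size at most three. [o] sends [B] to [z] and [C] to the base vertices.     *)
Variables (z : T) (B C : {set T}) (o : T -> T).
Hypotheses (zD : z \in D) (BD : {in B, forall x, x \in D}).
Hypotheses (CD : {in C, forall x, x \in D}).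
Hypotheses (oD : {in C, forall x, o x \in D}).
Hypotheses (oB : {in B, forall x, o x = z}).
Hypotheses (tB : {in B, forall x, t x != t z}) (tB_inj : {in B &, injective t}).
Hypotheses (toC : {in C, forall x, t (o x) = t x}).
Hypotheses (o_neq : {in C, forall x, o x != x}).
Hypotheses (tC : {in C, forall x, t x != t z}).
Hypotheses (tBC : {in B & C, forall x y, t x != t y}).
Hypotheses (oC : {in C &, forall x y, t x = t y -> o x = o y}).
Hypotheses (C3 : {in C & &, forall w x y, t x = t w -> t y = t w ->
  x != w -> y != w -> x = y}).

Let g x := f x - f (o x).

Let disjBC : [disjoint B & C].
Proof.
rewrite disjoint_subset; apply/subsetP => x xB; rewrite inE; apply/negP => xC.
by have := tBC xB xC; rewrite eqxx.
Qed.

Let dotBB : {in B &, forall x y, dot (g x) (g y) = 2^-1 * (1 + (x == y)%:R)}.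
Proof.
move=> x y xB yB; have [xD yD] := (BD xB, BD yB).
rewrite /g !oB //; case: eqVneq => [->|xy].
  by rewrite unit_f ?tB //=; lra.
rewrite dot_star ?tB // ?addr0 ?mulr1 //.
by apply: contra xy => /eqP /(tB_inj xB yB) ->.
Qed.

Let dotCB : {in C & B, forall x y, dot (g x) (g y) = 0}.
Proof.
move=> x y xC yB; have [xD oxD yD] := And3 (CD xC) (oD xC) (BD yB).
by rewrite /g (oB yB) dot_part ?toC ?(tBC yB xC) // eq_sym tC.
Qed.

Let dotCC : {in C &, forall x y, t x != t y -> dot (g x) (g y) = 0}.
Proof.
move=> x y xC yC txy; apply: dot_part; rewrite ?toC // 1?eq_sym //.
- exact: CD.
- exact: oD.
- exact: CD.
- exact: oD.
Qed.

Section Combination.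
Variables (l : T -> R) (e : 'rV[R]_n).
Hypothesis eE : e = \sum_(v in B :|: C) l v *: g v.

Let split_dot w : dot e w =
  \sum_(v in B) l v * dot (g v) w + \sum_(v in C) l v * dot (g v) w.
Proof.
rewrite eE dot_suml (eq_bigl [in [predU B & C]]); last first.
  by move=> v; rewrite !inE.
by rewrite bigU //=; congr (_ + _); apply: eq_bigr => v _; rewrite dotZl.
Qed.

(** The Gram matrix of the vectors [g v] over [B] is (I + J) / 2 with J all ones, so pairing with
    [g x] gives half of [l x] plus the total. The value s = 0 serves independence, s = 1/2 the final
    contradiction. *)
Lemma coef_star (s : R) : {in B, forall x, dot e (g x) = s} ->
  {in B, forall x, l x = s *+ 2 - \sum_(v in B) l v}.
Proof.
move=> es x xB; have := es x xB.
rewrite split_dot [X in _ + X]big1 ?addr0; last first.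
  by move=> v vC; rewrite dotCB // mulr0.
have -> : \sum_(v in B) l v * dot (g v) (g x) =
    2^-1 * (\sum_(v in B) l v + l x).
  rewrite (eq_bigr (fun v => 2^-1 * (l v + (if v == x then l v else 0)))).
    rewrite -mulr_sumr big_split; congr (_ * (_ + _)).
    rewrite -big_mkcondr /= (big_pred1 x) // => v.
    by rewrite /=; case: eqVneq => [->|]; rewrite ?xB ?andbF.
  by move=> v vB; rewrite dotBB //; case: eqP => _ /=; lra.
by move=> <-; rewrite mulr2n; lra.
Qed.

Lemma coef_star_sum (s : R) : {in B, forall x, dot e (g x) = s} ->
  (\sum_(v in B) l v) * (1 + #|B|%:R) = s *+ 2 * #|B|%:R.
Proof.
move=> es; set L := \sum_(v in B) l v.
have LE : L = (s *+ 2 - L) * #|B|%:R.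
  by rewrite {1}/L (eq_bigr _ (coef_star es)) sumr_const mulr_natr.
by rewrite mulrDr mulr1 {1}LE; ring.
Qed.

(** Distinct parts are orthogonal to each other and to [B], so the block of part [k] pairs with its
    own [g x] as [e] does; it is therefore orthogonal to itself. *)
Lemma part_comb0 (k : K) :
    {in C, forall x, t x = k -> dot e (g x) = 0} ->
  \sum_(v in C | t v == k) l v *: g v = 0.
Proof.
move=> ek; apply: dot_eq0; rewrite {1}dot_suml big1 // => x /andP[xC /eqP tx].
have := ek x xC tx; rewrite split_dot big1 ?add0r => [|v vB]; last first.
  by rewrite dotC dotCB ?mulr0.
rewrite (bigID (fun v => t v == k)) /=.
rewrite [X in _ + X]big1 ?addr0 => [|v]; last first.
  by move=> /andP[vC tv]; rewrite dotCC ?mulr0 // tx.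
move=> e0; rewrite dotZl dotC dot_suml.
by under eq_bigr do rewrite dotZl; rewrite e0 mulr0.
Qed.

End Combination.

Let g_neq0 : {in C, forall x, g x != 0}.
Proof.
move=> x xC; rewrite subr_eq0; apply: contra (o_neq xC) => /eqP fxo.
by rewrite [o x](inj_f (oD xC) (CD xC)).
Qed.

Lemma free_star (l : T -> R) : \sum_(v in B :|: C) l v *: g v = 0 ->
  {in B :|: C, forall v, l v = 0}.
Proof.
move=> /esym lE x; rewrite inE => /orP[xB|xC].
  have e0 : {in B, forall v, dot 0 (g v) = 0} by move=> v _; rewrite dot0l.
  have := coef_star_sum lE e0; rewrite mul0rn mul0r => /eqP.
  rewrite mulf_eq0 -(natrD R 1) pnatr_eq0 orbF => /eqP L0.
  by rewrite (coef_star lE e0 xB) L0 mul0rn subr0.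
have := @part_comb0 l 0 lE (t x) (fun v _ _ => dot0l _).
rewrite (bigD1 x) /=; last by rewrite xC eqxx.
have [y /and3P[yC /eqP tyx yx]|no] :=
    pickP [pred y | [&& y \in C, t y == t x & y != x]].
  rewrite (bigD1 y) /=; last by rewrite yC tyx eqxx.
  rewrite big_pred0 ?addr0 => [|v]; last first.
    apply/negP => /andP[/andP[/andP[vC /eqP tv] vx] /eqP]; apply.
    exact: C3 tv tyx vx yx.
  have [xD oxD yD] := And3 (CD xC) (oD xC) (CD yC).
  (* All points of this part are at distance 1 from [f z], hence on a sphere centred there. *)
  rewrite {2}/g (oC yC xC tyx); apply: (@sphere_free _ _ (f (o x) - f z)).
  - by rewrite /g addrC subrKA !unit_f ?toC ?tC.
  - by rewrite addrC subrKA !unit_f ?toC ?tC // tyx tC.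
  - exact: g_neq0.
  - by rewrite -(oC yC xC tyx) g_neq0.
  - apply: contra yx => /eqP/addIr/inj_f.
    by move=> ->.
rewrite big_pred0 ?addr0 => [/eqP|v]; last by rewrite -andbA; exact: no.
by rewrite scaler_eq0 (negPf (g_neq0 xC)) orbF => /eqP.
Qed.

(* If the [g v] spanned, then [f x - f z] and [f y - f z] would have the same *)
(* component along [B], of squared length less than 1/2, and otherwise        *)
(* orthogonal components; but their dot product is 1/2.                       *)
Lemma unit_distance_dim (x y : T) : x \in D -> y \in D ->
  t x != t z -> t y != t z -> t x != t y ->
  {in B, forall v, t x != t v} -> {in B, forall v, t y != t v} ->
  (#|B :|: C| < n)%N.
Proof.
move=> xD yD txz tyz txy txB tyB; rewrite ltnNge; apply/negP => leA.
have [l eE] := free_span_full free_star leA (f x - f z).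
have es : {in B, forall v, dot (f x - f z) (g v) = 2^-1}.
  move=> v vB; have vD := BD vB.
  by rewrite /g oB // dot_star ?(tB vB) ?(txB v vB).
have ek : {in C, forall v, t v = t y -> dot (f x - f z) (g v) = 0}.
  move=> v vC tv; have [vD ovD] := (CD vC, oD vC).
  by rewrite dotC /g dot_part ?toC ?tv // eq_sym.
have d0 := part_comb0 eE ek; have := coef_star_sum eE es.
have := dot_star zD xD yD txz tyz txy.
rewrite {1}eE dot_suml (eq_bigl [in [predU B & C]]); last first.
  by move=> v; rewrite !inE.
rewrite bigU //= [X in _ + X](bigID (fun v => t v == t y)) /=.
rewrite -[X in _ + (X + _)]dot_suml d0 dot0l add0r [X in _ + X]big1; last first.
  move=> v /andP[vC tv]; have [vD ovD] := (CD vC, oD vC).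
  by rewrite dotZl /g dot_part ?mulr0 ?toC // eq_sym ?tC.
rewrite (eq_bigr (fun v => l v * 2^-1)) => [|v vB]; last first.
  by have vD := BD vB; rewrite dotZl /g oB // dot_star ?(tB vB) // eq_sym tyB.
rewrite -mulr_suml; set L := \sum_(v in B) _ => e1 e2.
(* With L = 1, the sum formula reads 1 + |B| = |B|. *)
have L1 : L = 1 by lra.
by move: e2; rewrite L1 mulr2n; lra.
Qed.

End UnitDistance.

(** * Dimension bounds, signed-axis placements and vertex deletion *)

Section Graph.
Variables (R : realType) (T : finType).

Lemma edist1 (n : nat) (u v : 'rV[R]_n) :
  (edist u v = 1) <-> (dot (u - v) (u - v) = 1).
Proof.
have -> : dot (u - v) (u - v) = \sum_(i < n) (u 0 i - v 0 i) ^+ 2.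
  by apply: eq_bigr => i _; rewrite !mxE expr2.
rewrite /edist; set s := \sum_(i < n) _.
have s0 : 0 <= s by apply: sumr_ge0 => i _; exact: sqr_ge0.
split=> [e|->]; last exact: sqrtr1.
by rewrite -(sqr_sqrtr s0) e expr1n.
Qed.

Lemma dim_representable (G : graph T) : representable R G (Defs.dim R G).
Proof. by rewrite /Defs.dim; case: ex_minnP => n /asboolP. Qed.

Lemma dim_le (G : graph T) (n : nat) :
  representable R G n -> (Defs.dim R G <= n)%N.
Proof.
by move=> Gn; rewrite /Defs.dim; case: ex_minnP => m _; apply; apply/asboolP.
Qed.

(** Place [x] at plus or minus 1 / sqrt 2 on the axis [k x], with sign given by [eps x]: points on
    different axes are at distance 1. *)
Lemma representable_signed (G : graph T) (S : {set T}) (k : T -> T)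
    (eps : T -> bool) :
  (forall x, k x \in S) ->
  (forall x y, adj G x y -> k x != k y) ->
  (forall x y, k x = k y -> eps x = eps y -> x = y) ->
  representable R G #|S|.
Proof.
move=> kS kadj kinj; pose h : R := (Num.sqrt 2)^-1.
have h2 : h ^+ 2 = 2^-1 by rewrite /h exprVn sqr_sqrtr.
have h0 : h != 0 by rewrite -sqrf_eq0 h2 invr_eq0 pnatr_eq0.
pose rk x := enum_rank_in (kS x) (k x).
have rkK x : enum_val (rk x) = k x by rewrite enum_rankK_in.
pose s x : R := (-1) ^+ eps x * h.
have s2 x : s x * s x = 2^-1.
  by rewrite /s mulrACA -!expr2 sqrr_sign mul1r h2.
exists (fun x => \row_j (if j == rk x then s x else 0)); split.
  move=> x y _ _ /rowP/(_ (rk x)); rewrite !mxE eqxx.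
  have s0 : s x != 0 by rewrite mulf_eq0 signr_eq0.
  case: eqP => [e|_ /eqP]; last by rewrite (negPf s0).
  move=> /(mulIf h0) /signr_inj; apply: kinj.
  by rewrite -!rkK e.
move=> x y /kadj kxy; apply/edist1.
have rxy : rk y != rk x by apply: contra kxy => /eqP e; rewrite -!rkK e.
rewrite /dot (bigD1 (rk x)) //= (bigD1 (rk y)) //= big1.
  rewrite !mxE !eqxx eq_sym !(negPf rxy) subr0 sub0r mulrNN !s2; lra.
by move=> i /andP[ix iy]; rewrite !mxE (negPf ix) (negPf iy) subr0 mul0r.
Qed.

Section DelVertex.
Variables (G : graph T) (r : T).

Definition del_adj : rel T := fun x y => [&& adj G x y, x != r & y != r].

Lemma del_adj_sym : symmetric del_adj.
Proof. by move=> x y; rewrite /del_adj adj_sym [(x != r) && _]andbC. Qed.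

Lemma del_adj_irr : irreflexive del_adj.
Proof. by move=> x; rewrite /del_adj adj_irr. Qed.

Lemma del_adj_vset x y : del_adj x y -> x \in vset G :\ r.
Proof. by case/and3P=> /adj_vset xG xr _; rewrite !inE xr. Qed.

Definition del_vertex : graph T := Graph del_adj_sym del_adj_irr del_adj_vset.

Lemma del_vertex_proper : r \in vset G -> proper_subgraph del_vertex G.
Proof.
move=> rG; split; first by split=> [|x y /and3P[]//]; exact: subsetDl.
by case=> /subsetP/(_ r rG); rewrite !inE eqxx.
Qed.

End DelVertex.
End Graph.

(** * The two bounds for the complete multipartite graph *)

Section Multipartite.
Variables (a b c : nat).
Implicit Types (u v : mp_vertex a b c) (i : 'I_(a + b + c)).

Lemma part_size_gt0 i : (0 < part_size a b i)%N.
Proof. by rewrite /part_size; case: ifP => // _; case: ifP. Qed.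

Lemma part_size_le3 i : (part_size a b i <= 3)%N.
Proof. by rewrite /part_size; case: ifP => // _; case: ifP. Qed.

Lemma part_size_gt1 i : (1 < part_size a b i)%N = (a <= i)%N.
Proof. by rewrite /part_size [in RHS]leqNgt; case: ifP => // _; case: ifP. Qed.

Definition mp_pos v : nat := tagged v.

(* Position 0 if [p] is not a position of part [i]. *)
Definition mp_mk i (p : nat) : mp_vertex a b c :=
  Tagged (fun i : 'I_(a + b + c) => 'I_(part_size a b i))
    (insubd (Ordinal (part_size_gt0 i)) p).

Lemma mp_posE i p : (p < part_size a b i)%N -> mp_pos (mp_mk i p) = p.
Proof. by move=> pi; rewrite /mp_pos /= insubdK. Qed.

Lemma mp_eq u v : tag u = tag v -> mp_pos u = mp_pos v -> u = v.
Proof.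
case: u v => [i p] [j q] /= ij; case: _ / ij q => q /val_inj.
by rewrite /= => ->.
Qed.

Lemma mp_pos_lt v : (mp_pos v < part_size a b (tag v))%N.
Proof. exact: ltn_ord. Qed.

(* The vertices outside this set are the 0th vertices of the parts of size at *)
(* least two; they are placed opposite to the first vertices of these parts.  *)
Definition mp_axes : {set mp_vertex a b c} :=
  [set v : mp_vertex a b c | (tag v < a)%N || (0 < mp_pos v)%N].

Lemma mp_graph_representable (R : realType) :
  representable R (mp_graph a b c) #|mp_axes|.
Proof.
pose k v := if v \in mp_axes then v else mp_mk (tag v) 1.
have tk v : tag (k v) = tag v by rewrite /k; case: ifP.
(* The sign records membership in [mp_axes], so two vertices sharing an axis are antipodal. *)
apply: (@representable_signed _ _ _ _ k [in mp_axes]) => [x|x y|x y].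
- rewrite /k; case: ifP => // /negbT; rewrite !inE negb_or -leqNgt.
  by case/andP=> ax _; rewrite mp_posE ?orbT // part_size_gt1.
- by apply: contra => /eqP e; rewrite -tk e tk.
- move=> kxy; have txy : tag x = tag y by rewrite -tk kxy tk.
  move: kxy; rewrite /k => + e; rewrite -e; case: ifP => // xS _.
  apply: mp_eq => //; move: (xS); move: xS; rewrite {2}e !inE.
  by move=> /norP[_ +] /norP[_]; case: mp_pos => // ; case: mp_pos.
Qed.

(** Part [a] is the first of size two. Deleting its position 1 removes exactly one axis and leaves
    position 0 as the base point [z]. *)
Lemma mp_graph_del_lower (R : realType) (i : 'I_(a + b + c)) (n : nat) :
  i = a :> nat -> (1 <= b)%N -> (3 <= b + c)%N ->
  representable R (del_vertex (mp_graph a b c) (mp_mk i 1)) n ->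
  (#|mp_axes| <= n)%N.
Proof.
move=> ia b1 bc3 [f [f_inj f_unit]]; set r := mp_mk i 1 in f_inj f_unit *.
have si : part_size a b i = 2%N.
  by rewrite /part_size ia ltnn -{1}(addn0 a) ltn_add2l b1.
have posr : mp_pos r = 1%N by rewrite mp_posE // si.
pose z := mp_mk i 0.
have pos0 j : mp_pos (mp_mk j 0) = 0%N by rewrite mp_posE // part_size_gt0.
pose D : {set mp_vertex a b c} := [set~ r].
have mkD j : mp_mk j 0 \in D.
  by rewrite !inE; apply/eqP => /(congr1 mp_pos); rewrite posr pos0.
pose B : {set mp_vertex a b c} := [set v : mp_vertex a b c | (tag v < a)%N].
pose C : {set mp_vertex a b c} :=
  [set v : mp_vertex a b c | (a < tag v)%N && (0 < mp_pos v)%N].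
pose o v := if (tag v < a)%N then z else mp_mk (tag v) 0.
have neD v : tag v != i -> v \in D.
  by rewrite !inE; apply: contra => /eqP ->.
have BN : {in B, forall v, tag v != i}.
  by move=> v; rewrite inE -val_eqE /= ia ltn_neqAle => /andP[].
have CN : {in C, forall v, tag v != i}.
  by move=> v; rewrite inE -val_eqE /= ia ltn_neqAle eq_sym => /andP[/andP[]].
have oCE : {in C, forall v, o v = mp_mk (tag v) 0}.
  by move=> v; rewrite inE /o => /andP[/ltnW av _]; rewrite ltnNge av.
have unit_f : {in D &, forall x y, tag x != tag y ->
    dot (f x - f y) (f x - f y) = 1}.
  by move=> x y; rewrite !in_setC1 => xr yr xy; apply/edist1/f_unit/and3P.
have inj_f : {in D &, injective f}.
  by move=> x y; rewrite !in_setC1 => xr yr; apply: f_inj;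
    rewrite /= in_setD1 in_setT andbT.
have farB (j : 'I_(a + b + c)) : (a < j)%N -> {in B, forall v, j != tag v}.
  move=> aj v; rewrite inE => va.
  by rewrite -val_eqE /= gtn_eqF // (ltn_trans va aj).
have farz (j : 'I_(a + b + c)) : (a < j)%N -> j != i.
  by move=> aj; rewrite -val_eqE /= ia gtn_eqF.
(* Parts a + 1 and a + 2 supply the two extra points [x] and [y] of [unit_distance_dim]. *)
have lt1 : (a + 1 < a + b + c)%N.
  by rewrite -addnA ltn_add2l; apply: leq_trans bc3.
have lt2 : (a + 2 < a + b + c)%N by rewrite -addnA ltn_add2l.
pose j1 := Ordinal lt1; pose j2 := Ordinal lt2.
have aj1 : (a < j1)%N by rewrite /= addn1.
have aj2 : (a < j2)%N by rewrite /= addn2 ltnS leqnSn.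
have j12 : j1 != j2 by rewrite -val_eqE /= eqn_add2l.
(* In part [a] the only axis is [r]; all others lie in [B] or [C]. *)
have -> : #|mp_axes| = #|B :|: C|.+1.
  rewrite (cardsD1 r) inE posr orbT add1n; congr _.+1; apply: eq_card => v.
  rewrite !inE; case: (ltngtP (tag v) a) => [va|va|va] /=.
  - by rewrite andbT; apply: contraTneq va => ->; rewrite /= ia ltnn.
  - by rewrite andb_idl // => _; apply: contraTneq va => ->; rewrite /= ia ltnn.
  - have ti : tag v = i by apply: val_inj; rewrite /= ia.
    have := mp_pos_lt v; rewrite ti si; case pv: (mp_pos v) => [|[|//]] _.
      by rewrite andbF.
    rewrite andbT; apply/negbF/eqP/mp_eq => //.
    by rewrite posr.
apply: (@unit_distance_dim _ _ _ _ (@tag _ _) f D unit_f inj_f z B C o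
  _ _ _ _ _ _ _ _ _ _ _ _ _ (mp_mk j1 0) (mp_mk j2 0)).
- exact: mkD.
- by move=> v /BN/neD.
- by move=> v /CN/neD.
- by move=> v vC; rewrite oCE.
- by move=> v; rewrite inE /o => ->.
- exact: BN.
- move=> u v; rewrite !inE => ua va tuv; apply: mp_eq => //.
  have pos_single (w : mp_vertex a b c) : (tag w < a)%N -> mp_pos w = 0%N.
    by move=> wa; have := mp_pos_lt w; rewrite /part_size wa ltnS leqn0 => /eqP.
  by rewrite !pos_single.
- by move=> v vC; rewrite oCE.
- move=> v vC; rewrite oCE //; move: vC; rewrite inE => /andP[_].
  by apply: contraTneq => <-; rewrite pos0.
- exact: CN.
- move=> u v; rewrite !inE => ua /andP[av _].
  by rewrite -val_eqE /= ltn_eqF // (ltn_trans ua av).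
- by move=> u v uC vC tuv; rewrite !oCE // tuv.
- move=> w u v; rewrite !inE => /andP[_ w0] /andP[_ u0] /andP[_ v0] tu tv.
  move=> uw vw; apply: mp_eq; first by rewrite tu tv.
  have lt3 (x : mp_vertex a b c) : (mp_pos x < 3)%N.
    exact: leq_trans (mp_pos_lt x) (part_size_le3 _).
  have neq (x : mp_vertex a b c) :
      tag x = tag w -> x != w -> mp_pos x != mp_pos w.
    by move=> tx; apply: contra => /eqP pe; apply/eqP/mp_eq.
  have := neq _ tu uw; have := neq _ tv vw; move: u0 v0 w0.
  by move: (lt3 u) (lt3 v) (lt3 w); lia.
- exact: mkD.
- exact: mkD.
- exact: farz.
- exact: farz.
- exact: j12.
- exact: farB.
- exact: farB.
Qed.

End Multipartite.

Theorem theorem2p4 (R : realType) (a b c : nat) (hb : (1 <= b)%N)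
  (hbc : (3 <= b + c)%N) : ~ dim_critical R (mp_graph a b c).
Proof.
case=> _ crit; have ia : (a < a + b + c)%N.
  by rewrite -addnA -{1}(addn0 a) ltn_add2l (leq_trans _ hbc).
pose r := mp_mk (Ordinal ia) 1.
have := crit _ (@del_vertex_proper _ (mp_graph a b c) r (in_setT _)).
rewrite ltnNge => /negP; apply.
apply: leq_trans (dim_le (mp_graph_representable a b c R)) _.
by apply: mp_graph_del_lower (dim_representable _ _).
Qed.
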